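(* Consider two executions satisfying (A1)–(A5), with causal structure graphs $G_1^*$ and $G_2^*$. With respect to all upper-layer computations that use only (i) ancestor and concurrency queries on the causal structure graph and (ii) semilattice-homomorphic aggregates over payloads, the two executions are observationally indistinguishable if and only if $G_1^*$ and $G_2^*$ are isomorphic.
   Context: Model. $V=\{1,\dots,n\}$ is a finite set of agents and $K$ a set of keys. Each key $k$ has a state space $(L_k,\sqsubseteq,\sqcup)$. A contribution is a tuple $\delta=(\mathrm{rid},\mathrm{parents},\mathrm{payload},k)$: $\mathrm{rid}$ is an identifier, $\mathrm{parents}$ is a finite set of rids (the direct causal predecessors), $\mathrm{payload}$ is application data, merged as an element of $L_k$, and $k\in K$ is a key. $\mathrm{Rel}(k)\subseteq V$ is the set of agents subscribing to key $k$. In an execution, agents create contributions over time and messages carry contributions between agents asynchronously over a network that may lose, duplicate and reorder messages. Axioms: (A1) Localized weak fairness: for each key $k$, if a contribution of key $k$ is persistently sent, it is eventually delivered at least once to every agent in $\mathrm{Rel}(k)$. (A2) For each key $k$, $(L_k,\sqsubseteq,\sqcup)$ is a directed-complete join-semilattice: a partially ordered set with binary joins $\sqcup$ (associative, commutative, idempotent) in which every directed subset has a supremum. (A3) Every contribution is an immutable fact: its rid is globally unique and its payload is immutable upon creation. (A4) The parents set of every contribution is immutable upon creation. (A5) Causal well-formedness: when an agent creates a contribution, all rids in its parents set are drawn from the contributions already observed by that agent at the time of creation. The causal structure graph (DCS graph) of an execution is the directed acyclic graph $G^*=(\mathcal{R},E)$, where $\mathcal{R}$ is the set of rids of all contributions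 generated and $E=\{(p\to r)\mid p\in\mathrm{parents}(r)\}$; each vertex carries the payload of its contribution. An isomorphism of two such graphs is a bijection between the vertices that preserves rids, parents relations and payloads. An ancestor query asks, for rids $p,r$, whether there is a directed path from $p$ to $r$; a concurrency query asks whether neither of $p,r$ is an ancestor of the other. A semilattice-homomorphic aggregate is a value of the form $h\big(\bigsqcup_{r\in S}\mathrm{payload}(r)\big)$ for a set $S$ of contributions of one key and a join-semilattice homomorphism $h$. Two executions are observationally indistinguishable with respect to a class of computations if every computation in the class yields the same result on both.
   Formalization: Parents are required to be direct causal predecessors: no contribution lies causally strictly between a parent and its child. With redundant parents (a→b→c with or without a→c) the claim fails, since ancestor, concurrency and aggregate queries agree but the graphs are not isomorphic. *)

(* Defs.v *)
From Stdlib Require Import Relation_Operators.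
From mathcomp Require Import all_boot all_order finmap.
From mathcomp Require Import boolp classical_sets functions.

Set Implicit Arguments.
Unset Strict Implicit.
Unset Printing Implicit Defensive.

Local Open Scope order_scope.
Local Open Scope classical_set_scope.

Section StateSpaces.
Context {d : Order.disp_t}.

Definition directed (T : porderType d) (D : set T) : Prop :=
  D !=set0 /\
  forall x y, D x -> D y -> exists z, [/\ D z, x <= z & y <= z].

Definition directed_complete (T : porderType d) : Prop :=
  forall D : set T, directed D -> supremums D !=set0.

End StateSpaces.

Section Model.
Context {n : nat} {K : Type} {Rid : choiceType} {d : Order.disp_t}
  {L : K -> joinSemilatticeType d}.

Record contribution := Contribution {
  rid : Rid;
  parents : {fset Rid};
  key : K;
  payload : L key
}.

(* Payloads of different keys live in different state spaces, so a payload is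
   compared together with its key. *)
Definition kpayload (c : contribution) : {k : K & L k} :=
  existT (fun k => L k) (key c) (payload c).

(* The agents are the elements of 'I_n.  [Send i c]: agent i puts a copy of c on
   the network; [Deliver i c]: a copy of c reaches agent i. *)
Inductive event :=
  | Create of 'I_n & contribution
  | Send of 'I_n & contribution
  | Deliver of 'I_n & contribution.

Definition carried (e : event) : contribution :=
  match e with Create _ c | Send _ c | Deliver _ c => c end.

(* An interleaving of the events of all agents; at a time mapped to [None]
   nothing happens, so finite runs are included. *)
Definition trace := nat -> option event.

Section Trace.
Variable T : trace.

Definition occurs (t : nat) (e : event) : Prop := T t = Some e.

Definition observed (i : 'I_n) (t : nat) (c : contribution) : Prop :=
  exists2 s, (s < t)%N & occurs s (Create i c) \/ occurs s (Deliver i c).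

Definition generated (c : contribution) : Prop :=
  exists t i, occurs t (Create i c).

Definition parent_of (p r : Rid) : Prop :=
  exists c, [/\ generated c, rid c = r & p \in parents c].

(* The network may lose (nothing forces a delivery), duplicate and reorder
   copies, but every delivered copy has been sent before. *)
Definition network_integrity : Prop :=
  forall t j c, occurs t (Deliver j c) ->
    exists s i, (s < t)%N /\ occurs s (Send i c).

(* Only the rid is compared: that the copy sent has the original payload and
   parents is left to the immutability axioms. *)
Definition send_integrity : Prop :=
  forall t i c, occurs t (Send i c) ->
    exists2 c', observed i t c' & rid c' = rid c.

(* [parents] lists the direct causal predecessors only: no contribution lies
   causally strictly between p and r when p is a parent of r.  With redundant
   parents (a -> b -> c together with a -> c) ancestry would not determine the
   parents relation. *)
Definition direct_parents : Prop :=
  forall p r, parent_of p r ->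
    ~ exists q, clos_trans Rid parent_of p q /\ clos_trans Rid parent_of q r.

End Trace.

Record execution := Execution {
  trace_of :> trace;
  execution_send : send_integrity trace_of;
  execution_network : network_integrity trace_of;
  execution_parents : direct_parents trace_of
}.

Definition persistently_sent (T : trace) (c : contribution) : Prop :=
  forall t, exists s i, (t <= s)%N /\ occurs T s (Send i c).

Definition localized_weak_fairness (Rel : K -> {set 'I_n}) (T : trace) : Prop :=
  forall k c, key c = k -> persistently_sent T c ->
    forall i, i \in Rel k -> exists t, occurs T t (Deliver i c).

Definition unique_rids (T : trace) : Prop :=
  forall t t' i j c c', occurs T t (Create i c) -> occurs T t' (Create j c') ->
    rid c = rid c' -> t = t'.

Definition immutable_payloads (T : trace) : Prop :=
  forall t i c t' e, occurs T t (Create i c) -> occurs T t' e ->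
    rid (carried e) = rid c -> kpayload (carried e) = kpayload c.

Definition immutable_parents (T : trace) : Prop :=
  forall t i c t' e, occurs T t (Create i c) -> occurs T t' e ->
    rid (carried e) = rid c -> parents (carried e) = parents c.

Definition causally_well_formed (T : trace) : Prop :=
  forall t i c, occurs T t (Create i c) -> forall p, p \in parents c ->
    exists2 c', observed T i t c' & rid c' = p.

Record satisfies_axioms (Rel : K -> {set 'I_n}) (T : trace) : Prop := SatisfiesAxioms {
  A1 : localized_weak_fairness Rel T;
  A2 : forall k, directed_complete (L k);
  A3 : unique_rids T /\ immutable_payloads T;
  A4 : immutable_parents T;
  A5 : causally_well_formed T
}.

(* [carries G r x]: the vertex r carries x.  It is a relation so that the graph
   of a trace is defined without assuming that rids are unique. *)
Record dcs_graph := DCSGraph {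
  vertex : set Rid;
  edge : Rid -> Rid -> Prop;
  carries : Rid -> {k : K & L k} -> Prop
}.

Definition dcs (T : trace) : dcs_graph := {|
  vertex := [set r | exists2 c, generated T c & rid c = r];
  edge := parent_of T;
  carries := fun r x => exists c, [/\ generated T c, rid c = r & kpayload c = x]
|}.

Definition isomorphic (G1 G2 : dcs_graph) : Prop :=
  exists f : Rid -> Rid,
    [/\ set_bij (vertex G1) (vertex G2) f,
        forall r, vertex G1 r -> f r = r,
        forall p r, vertex G1 p -> vertex G1 r ->
          (edge G1 p r <-> edge G2 (f p) (f r))
      & forall r x, vertex G1 r -> (carries G1 r x <-> carries G2 (f r) x)].

(* Paths may have length zero: every vertex is an ancestor of itself. *)
Definition ancestor (G : dcs_graph) (p r : Rid) : Prop :=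
  [/\ vertex G p, vertex G r & clos_refl_trans Rid (edge G) p r].

Definition concurrent (G : dcs_graph) (p r : Rid) : Prop :=
  ~ ancestor G p r /\ ~ ancestor G r p.

(* x is the join of the payloads of S, a set of contributions of key k; S may be
   infinite, so the join is a supremum. *)
Definition is_join (G : dcs_graph) (k : K) (S : set Rid) (x : L k) : Prop :=
  (forall r, S r -> exists y : L k, carries G r (existT _ k y)) /\
  supremums [set y : L k | exists2 r, S r & carries G r (existT _ k y)] x.

(* [None] when S is not a set of contributions of key k, or when S is empty and
   L k has no least element. *)
Definition aggregate (G : dcs_graph) (k : K) (S : set Rid)
    (d' : Order.disp_t) (M : joinSemilatticeType d') (h : L k -> M) : option M :=
  match pselect (exists x, is_join G S x) with
  | left ex => Some (h (projT1 (cid ex)))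
  | right _ => None
  end.

Inductive query :=
  | AncestorQuery (p r : Rid)
  | ConcurrencyQuery (p r : Rid)
  | AggregateQuery (k : K) (S : set Rid) (d' : Order.disp_t)
      (M : joinSemilatticeType d') (h : L k -> M)
      of {morph h : x y / Order.join x y >-> Order.join x y}.

Definition answer_type (q : query) : Type :=
  match q with
  | AncestorQuery _ _ | ConcurrencyQuery _ _ => bool
  | @AggregateQuery _ _ _ M _ _ => option M
  end.

Definition answer (G : dcs_graph) (q : query) : answer_type q :=
  match q return answer_type q with
  | AncestorQuery p r => `[< ancestor G p r >]
  | ConcurrencyQuery p r => `[< concurrent G p r >]
  | @AggregateQuery _ A _ _ h _ => aggregate G A h
  end.

(* A computation sees an execution only through the answers to its queries.  It
   may query adaptively: the set S of an aggregate can depend on other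
   answers. *)
Definition computation (Out : Type) : Type :=
  (forall q : query, answer_type q) -> Out.

Definition run (Out : Type) (c : computation Out) (T : trace) : Out :=
  c (answer (dcs T)).

Definition indistinguishable (T1 T2 : trace) : Prop :=
  forall (Out : Type) (c : computation Out), run c T1 = run c T2.

End Model.

Arguments contribution {K} Rid {d} L.
Arguments trace n {K} Rid {d} L.
Arguments execution n {K} Rid {d} L.

(* Main.v *)
Require Import Defs.
From Stdlib Require Import Relation_Operators Operators_Properties.
From mathcomp Require Import all_boot all_order finmap.
From mathcomp Require Import boolp classical_sets functions.

(** Isomorphisms fix rids, so isomorphic graphs with edges between vertices only
    are equal, and equal graphs answer every query alike.  Conversely, the
    vertices are the rids that are ancestors of themselves; since parents are
    direct causal predecessors, the edges are the covering pairs of ancestry; and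
    the payload of a vertex is the identity aggregate over its singleton. *)

Set Implicit Arguments.
Unset Strict Implicit.
Unset Printing Implicit Defensive.

Local Open Scope classical_set_scope.

Section CoveringPairs.
Variable A : Type.

Lemma clos_refl_trans_neq (R : A -> A -> Prop) (x y : A) :
  clos_refl_trans A R x y -> x <> y -> clos_trans A R x y.
Proof.
elim=> [{}x {}y Rxy _|//|{}x {}y z _ IHxy Ryz IHyz xz]; first exact: t_step.
have [xy|/IHxy tr_xy] := pselect (x = y); first by move: xz; rewrite xy.
have [<-//|/IHyz tr_yz] := pselect (y = z).
exact: t_trans tr_xy tr_yz.
Qed.

(** If the [R2]-path that replaces an [R1]-edge had an intermediate point after its first step, that
    point would lie strictly between the ends of the edge for [R1] as well. *)
Lemma clos_refl_trans_covering (R1 R2 : A -> A -> Prop) :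
    (forall x y, R1 x y ->
      ~ exists z, clos_trans A R1 x z /\ clos_trans A R1 z y) ->
    (forall x, ~ R2 x x) ->
    (forall x y, clos_refl_trans A R1 x y <-> clos_refl_trans A R2 x y) ->
  forall x y, R1 x y -> R2 x y.
Proof.
move=> cover1 irr2 R12 x y R1xy.
have xy : x <> y.
  move=> xy; move: R1xy; rewrite -xy => R1xx.
  by apply: (cover1 _ _ R1xx); exists x; split; apply: t_step.
have tr2 : clos_trans_1n A R2 x y.
  by apply/clos_trans_t1n/clos_refl_trans_neq => //; apply/R12/rt_step.
(* Peel off the first [R2]-step: it either reaches [y], as wanted, or stops at some [z]. *)
case: tr2 R1xy xy => // z {}y R2xz zy_t1n R1xy xy.
have tr2_zy := clos_t1n_trans _ _ _ _ zy_t1n.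
have [<-//|zy] := pselect (z = y).
have xz : x <> z by move=> xz; apply: (irr2 x); rewrite {2}xz.
case: (cover1 _ _ R1xy); exists z; split.
  by apply: clos_refl_trans_neq => //; apply/R12/rt_step.
by apply: clos_refl_trans_neq => //; apply/R12/clos_t_clos_rt.
Qed.

End CoveringPairs.

Section Executions.
Context {n : nat} {K : Type} {Rid : choiceType} {d : Order.disp_t}
  {L : K -> joinSemilatticeType d}.
Implicit Types (G : @dcs_graph K Rid d L) (e : execution n Rid L).

(** Induction on time: a delivery traces back to a send, and the sender had observed a contribution
    with the same rid strictly earlier. *)
Lemma observed_vertex e i t c :
  observed e i t c -> vertex (dcs e) (rid c).
Proof.
elim/ltn_ind: t i c => t IH i c [s st [created|delivered]].
  by exists c => //; exists s, i.
have [u [j [us sent]]] := execution_network delivered.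
have [c' obs <-] := execution_send sent.
exact: IH (ltn_trans us st) _ _ obs.
Qed.

(** Isomorphisms and ancestor queries constrain edges only between vertices; this extends the
    comparison to all of [Rid]. *)
Lemma edge_vertices e p r : causally_well_formed e ->
  edge (dcs e) p r -> vertex (dcs e) p /\ vertex (dcs e) r.
Proof.
move=> cwf [c [gen <- pc]]; split; last by exists c.
case: (gen) => t [i created]; have [c' obs <-] := cwf _ _ _ created _ pc.
exact: observed_vertex obs.
Qed.

(** Immutability constrains every event carrying the rid, in particular another creation. *)
Lemma carries_inj e r x y : immutable_payloads e ->
  carries (dcs e) r x -> carries (dcs e) r y -> x = y.
Proof.
move=> imm [c [[t [i gen]] rc <-]] [c' [[t' [i' gen']] rc' <-]].
by apply: (imm _ _ _ _ _ gen' gen); rewrite /= rc rc'.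
Qed.

Lemma edge_irrefl e r : ~ edge (dcs e) r r.
Proof.
move=> rr; apply: (execution_parents rr).
by exists r; split; apply: t_step.
Qed.

(** Literal equality lets all answers be rewritten at once. Edges and payloads involve vertices
    only, so agreement there suffices. *)
Lemma isomorphic_dcs_eq e1 e2 :
    causally_well_formed e1 -> causally_well_formed e2 ->
  isomorphic (dcs e1) (dcs e2) -> dcs e1 = dcs e2.
Proof.
move=> cwf1 cwf2 [f [[f12 _ f21] fid fE fC]].
have vE r : vertex (dcs e1) r <-> vertex (dcs e2) r.
  split=> [v|/f21[s v <-]]; last by rewrite fid.
  by rewrite -(fid _ v); apply: f12.
rewrite /dcs; congr DCSGraph.
- by apply/funext => r; apply/propext/vE.
- apply/funext => p; apply/funext => r; apply/propext; split=> E.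
    have [vp vr] := edge_vertices cwf1 E.
    by move/fE: E => /(_ vp vr); rewrite !fid.
  have [/vE vp /vE vr] := edge_vertices cwf2 E.
  by apply/(fE _ _ vp vr); rewrite !fid.
- apply/funext => r; apply/funext => x; apply/propext; split=> C.
    have v : vertex (dcs e1) r by case: C => c [gen rc _]; exists c.
    by move/(fC _ _ v): C; rewrite fid.
  have /vE v : vertex (dcs e2) r by case: C => c [gen rc _]; exists c.
  by apply/(fC _ _ v); rewrite fid.
Qed.

Lemma aggregate_id_is_join G (k : K) (S : set Rid) (x : L k) :
  aggregate G S (@id (L k)) = Some x -> is_join G S x.
Proof.
by rewrite /aggregate; case: pselect => // ex [<-]; case: (cid ex).
Qed.

Lemma is_join_set1 e (k : K) r (x : L k) : immutable_payloads e ->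
  is_join (dcs e) [set r] x <-> carries (dcs e) r (existT _ k x).
Proof.
move=> imm.
have supE (y : L k) : carries (dcs e) r (existT _ k y) ->
    [set z : L k | exists2 s, [set r] s & carries (dcs e) s (existT _ k z)]
      = [set y].
  move=> Cy; apply/seteqP; split=> [z /= [s -> Cz]|z /= ->]; last by exists r.
  (* [{classic K}] equips [K] with the decidable equality that injectivity of dependent pairs asks
     for. *)
  exact/(@existT_inj2 {classic K} L)/(carries_inj imm Cz Cy).
split=> [[keyr]|Cx].
  (* The key condition of [is_join] supplies a payload, which excludes the empty join, a least
     element. *)
  have [y Cy] := keyr r erefl.
  by rewrite (supE _ Cy) supremums1 => ->.
split; first by move=> _ ->; exists x.
by rewrite (supE _ Cx) supremums1.
Qed.

(** [aggregate] picks its join by choice; over a singleton, uniqueness of the payload determines the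
    pick. *)
Lemma aggregate_id_set1 e (k : K) r (x : L k) : immutable_payloads e ->
  aggregate (dcs e) [set r] (@id (L k)) = Some x <->
  carries (dcs e) r (existT _ k x).
Proof.
move=> imm; split=> [/aggregate_id_is_join/is_join_set1|Cx]; first exact.
rewrite /aggregate; case: pselect => [ex|[]]; last first.
  by exists x; apply/is_join_set1.
congr Some; case: (cid ex) => y /= /(is_join_set1 _ _ imm) Cy.
exact/(@existT_inj2 {classic K} L)/(carries_inj imm Cy Cx).
Qed.

Lemma indistinguishable_ancestor (T1 T2 : trace n Rid L) p r :
  indistinguishable T1 T2 -> ancestor (dcs T1) p r <-> ancestor (dcs T2) p r.
Proof.
move=> /(_ bool (fun a => a (AncestorQuery p r))); rewrite /run /= => eq12.
by split=> /asboolP A; apply/asboolP; move: A; rewrite eq12.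
Qed.

Lemma indistinguishable_aggregate (T1 T2 : trace n Rid L) (k : K) S :
  indistinguishable T1 T2 ->
  aggregate (dcs T1) S (@id (L k)) = aggregate (dcs T2) S (@id (L k)).
Proof.
pose q := @AggregateQuery K Rid d L k S d (L k) id (fun _ _ => erefl).
by move=> /(_ (option (L k)) (fun a => a q)).
Qed.

Lemma vertex_ancestor G r : vertex G r <-> ancestor G r r.
Proof. by split=> [v|[]//]; split=> //; apply: rt_refl. Qed.

(** The closure ranges over all of [Rid] and also relates each non-vertex to itself, hence the
    disjunct [p = r]. *)
Lemma ancestor_clos_refl_trans e p r : causally_well_formed e ->
  clos_refl_trans Rid (edge (dcs e)) p r <-> p = r \/ ancestor (dcs e) p r.
Proof.
move=> cwf; split=> [|[->|[]//]]; last exact: rt_refl.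
elim=> {p r} [p r E|p|p q r _ [->//|pq] _ [<-|qr]]; first 1 last.
- by left.
- by right.
- right; case: pq qr => vp _ pq [_ vr qr]; split=> //; exact: rt_trans pq qr.
by have [vp vr] := edge_vertices cwf E; right; split=> //; apply: rt_step.
Qed.

Lemma indistinguishable_isomorphic e1 e2 :
    causally_well_formed e1 -> causally_well_formed e2 ->
    immutable_payloads e1 -> immutable_payloads e2 ->
  indistinguishable e1 e2 -> isomorphic (dcs e1) (dcs e2).
Proof.
move=> cwf1 cwf2 imm1 imm2 ind.
have anc p r := @indistinguishable_ancestor _ _ p r ind.
have vE r : vertex (dcs e1) r <-> vertex (dcs e2) r.
  by rewrite !vertex_ancestor.
have rtE p r : clos_refl_trans Rid (edge (dcs e1)) p r <->
               clos_refl_trans Rid (edge (dcs e2)) p r.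
  by rewrite !ancestor_clos_refl_trans // anc.
(* An isomorphism must fix rids, so the identity is the only candidate on vertices. *)
exists id; split=> //.
- split=> [r /vE//||r /vE v]; first by move=> p r _ _.
  by exists r.
- move=> p r _ _; split.
    by apply: clos_refl_trans_covering rtE _ _;
      [exact: execution_parents|exact: edge_irrefl].
  apply: clos_refl_trans_covering => [||x y]; last by rewrite rtE.
    exact: execution_parents.
  exact: edge_irrefl.
- move=> r [k x] _.
  by rewrite -!aggregate_id_set1 // (indistinguishable_aggregate _ _ ind).
Qed.

End Executions.

Theorem proposition1 (n : nat) (K : Type) (Rid : choiceType) (d : Order.disp_t)
    (L : K -> joinSemilatticeType d) (Rel : K -> {set 'I_n})
    (e1 e2 : execution n Rid L) :
  satisfies_axioms Rel e1 -> satisfies_axioms Rel e2 ->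
  indistinguishable e1 e2 <-> isomorphic (dcs e1) (dcs e2).
Proof.
move=> [_ _ [_ imm1] _ cwf1] [_ _ [_ imm2] _ cwf2]; split.
  exact: indistinguishable_isomorphic.
by move=> /(isomorphic_dcs_eq cwf1 cwf2) eq12 Out c; rewrite /run eq12.
Qed.
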